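(* Let $\widehat{X}=(X,h)$ be a generalized $N$-dimensional rectangle of a metric space $Z$. Assume that, for each $i\in\{1,\dots,N\}$, there exists a compact set $\mathcal S_i\subseteq X$ such that $\mathcal S_i$ cuts the arcs between $X_i^{\ell}$ and $X_i^{r}$ in $X$. Then $$\bigcap_{i=1}^N \mathcal S_i\neq\emptyset.$$
   Context: $I^N=[0,1]^N$, and $[x_i=k]=\{x\in I^N: x_i=k\}$. A generalized $N$-dimensional rectangle of a metric space $Z$ is a pair $\widehat X=(X,h)$ where $X\subseteq Z$ and $h:I^N\to X$ is a homeomorphism of $I^N$ onto $X$. Its left and right $i$-faces are $X_i^{\ell}=h([x_i=0])$ and $X_i^{r}=h([x_i=1])$. A path in a space is a continuous map $\gamma:[0,1]\to X$; $\overline\gamma=\gamma([0,1])$ denotes its range. Given closed nonempty sets $A,B,C\subseteq X$ with $A\cap B=\emptyset$ in an arcwise connected metric space $X$, we say that $C$ cuts the arcs between $A$ and $B$ (in $X$) if every path $\gamma:[0,1]\to X$ with $\overline\gamma\cap A\neq\emptyset$ and $\overline\gamma\cap B\neq\emptyset$ satisfies $\overline\gamma\cap C\neq\emptyset$. *)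

(* Defs.v *)
From HB Require Import structures.
From mathcomp Require Import all_boot all_order all_algebra.
From mathcomp Require Import all_classical all_reals all_analysis.
Import Order.TTheory GRing.Theory Num.Theory.
Import numFieldNormedType.Exports.

Set Implicit Arguments.
Unset Strict Implicit.
Unset Printing Implicit Defensive.

Local Open Scope classical_set_scope.
Local Open Scope ring_scope.

Definition unit_cube (R : realType) (N : nat) : set 'rV[R]_N :=
  [set x | forall i : 'I_N, 0 <= x ord0 i <= 1].

Definition cube_slice (R : realType) (N : nat) (i : 'I_N) (k : R) :
    set 'rV[R]_N :=
  [set x | unit_cube x /\ x ord0 i = k].

(* Homeomorphism of the subspace A onto the subspace B; the values of f
   outside A play no role. *)
Definition homeomorphism_on (T U : topologicalType) (A : set T) (B : set U)
    (f : T -> U) : Prop :=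
  [/\ set_bij A B f,
      {within A, continuous f} &
      exists2 g : U -> T,
        (forall x, A x -> g (f x) = x) & {within B, continuous g}].

Definition generalized_rectangle (R : realType) (N : nat) (Z : metricType R)
    (X : set Z) (h : 'rV[R]_N -> Z) : Prop :=
  homeomorphism_on (@unit_cube R N) X h.

Definition left_face (R : realType) (N : nat) (Z : metricType R)
    (h : 'rV[R]_N -> Z) (i : 'I_N) : set Z :=
  h @` cube_slice i 0.

Definition right_face (R : realType) (N : nat) (Z : metricType R)
    (h : 'rV[R]_N -> Z) (i : 'I_N) : set Z :=
  h @` cube_slice i 1.

Definition path_range (R : realType) (Z : topologicalType) (gamma : R -> Z) :
    set Z :=
  gamma @` `[0, 1].

Definition is_path (R : realType) (Z : topologicalType) (X : set Z)
    (gamma : R -> Z) : Prop :=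
  {within `[0, 1], continuous gamma} /\ path_range gamma `<=` X.

(* The usual side conditions (A, B, C closed, nonempty subsets of X, A and B
   disjoint, X arcwise connected) are not part of the predicate. *)
Definition cuts_arcs (R : realType) (Z : metricType R) (X A B C : set Z) :
    Prop :=
  forall gamma : R -> Z, is_path X gamma ->
    path_range gamma `&` A !=set0 -> path_range gamma `&` B !=set0 ->
    path_range gamma `&` C !=set0.

(* Main.v *)
Require Import Defs.
From HB Require Import structures.
From mathcomp Require Import all_boot all_order all_algebra.
From mathcomp Require Import all_classical all_reals all_analysis.
From mathcomp Require Import zify lra.
Import Order.TTheory GRing.Theory Num.Theory.
Import numFieldNormedType.Exports.

Local Open Scope classical_set_scope.
Local Open Scope ring_scope.

(* Pull everything back to the cube, where [S i] becomes a closed set [K i], and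
   label [x] by whether, for each [i], it lies on the face [x_i = 0] or can be
   reached from it by a path avoiding [K i].  Two points of a small grid cube
   with different [i]-labels are joined by a segment, which must meet [K i].  By
   Kuhn's cubical Sperner lemma every grid has a cube on which all [N] labels
   vary; such a cube meets every [K i], and a cluster point of these cubes lies
   in all of them.
   Kuhn's lemma is proved cohomologically: over [F_2], the sum over all grid
   cubes of the cup product [d l_1 \cup ... \cup d l_N] telescopes, by Stokes,
   to the same sum in one dimension less on the face [q_N = p], hence is 1. *)

(** * Cubical cochains over [F_2] and their coboundary *)

Section Cube.
Context {I : finType}.
Implicit Types (q : I -> nat) (i j : I) (A B : {set I}).
Implicit Types (g : (I -> nat) -> 'F_2).

Definition corner A q : I -> nat := fun j => (q j + (j \in A))%N.
Definition upd i t q : I -> nat := fun j => if j == i then t else q j.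

Lemma addF2 (x : 'F_2) : x + x = 0.
Proof. exact: (addrr_pchar2 (pchar_Fp (isT : prime 2))). Qed.

Lemma addF2_eq0 (x y : 'F_2) : x + y = 0 -> x = y.
Proof. by move/(congr1 (+%R^~ y)); rewrite -addrA addF2 addr0 add0r. Qed.

Lemma corner_setD1 A i q : i \in A ->
  corner (A :\ i) (corner [set i] q) = corner A q.
Proof.
move=> iA; apply/funext => j; rewrite /corner !inE.
by have [->|] := eqVneq j i; rewrite /= ?iA ?addn0.
Qed.

Lemma cornerC A B q : corner B (corner A q) = corner A (corner B q).
Proof. by apply/funext => j; rewrite /corner addnAC. Qed.

Lemma updC i j s t q : i != j -> upd i s (upd j t q) = upd j t (upd i s q).
Proof.
move=> ij; apply/funext => k; rewrite /upd.
by case: (eqVneq k i) => // ->; rewrite (negbTE ij).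
Qed.

Lemma corner_upd i t q : corner [set i] (upd i t q) = upd i t.+1 q.
Proof.
apply/funext => j; rewrite /corner /upd inE.
by case: eqP; rewrite ?addn1 ?addn0.
Qed.

(** The terms at [(i, j)] and [(j, i)] are equal and cancel in characteristic 2. *)
Lemma sum_offdiag_sym_F2 A (f : I -> I -> 'F_2) : (forall i j, f i j = f j i) ->
  \sum_(i in A) \sum_(j in A :\ i) f i j = 0.
Proof.
move=> fC; rewrite pair_big_dep/=.
rewrite (bigID (fun x : I * I => (enum_rank x.1 < enum_rank x.2)%N))/=.
rewrite [X in _ + X](reindex (fun x : I * I => (x.2, x.1)))/=; last first.
  by exists (fun x => (x.2, x.1)) => -[].
pose P (x : I * I) :=
  [&& x.1 \in A, x.2 \in A :\ x.1 & (enum_rank x.1 < enum_rank x.2)%N].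
rewrite [X in _ + X](eq_big P (fun x => f x.1 x.2)).
- by rewrite [X in X + _](eq_bigl P) ?addF2// => x; rewrite /P andbA.
- case=> i j; rewrite /P /= !inE -leqNgt leq_eqVlt (inj_eq val_inj).
  rewrite (inj_eq enum_rank_inj) eq_sym.
  by case: (eqVneq j i) => //=; rewrite ?andbF// andbA [(j \in A) && _]andbC.
- by case=> i j _ /=; rewrite fC.
Qed.

(* A cubical cochain assigns an element of [F_2] to each face [q + [0,1]^A]. *)
Definition coboundary (w : {set I} -> (I -> nat) -> 'F_2) A q : 'F_2 :=
  \sum_(i in A) (w (A :\ i) (corner [set i] q) + w (A :\ i) q).

(** The four terms obtained by dropping [i] and then [j] are together symmetric in [i] and [j], so
    they cancel in pairs. *)
Lemma coboundary_coboundary w A q : coboundary (coboundary w) A q = 0.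
Proof.
pose f i j := w (A :\ i :\ j) (corner [set j] (corner [set i] q)) +
  (w (A :\ i :\ j) (corner [set i] q) + w (A :\ i :\ j) (corner [set j] q)) +
  w (A :\ i :\ j) q.
rewrite -[RHS](@sum_offdiag_sym_F2 A f) => [|i j].
  apply: eq_bigr => i _; rewrite -big_split/=; apply: eq_bigr => j _.
  by rewrite /f !addrA.
rewrite /f (_ : A :\ i :\ j = A :\ j :\ i); last first.
  by apply/setP => k; rewrite !inE andbCA.
by rewrite cornerC [X in _ + X + _]addrC.
Qed.

(** * Cup products of the coboundaries of the labels *)

Variable l : I -> (I -> nat) -> 'F_2.

(* The cup product of the coboundaries [d l_i] for [i] in [s], the head of [s]
   being the last factor. *)
Fixpoint cup (s : seq I) A q : 'F_2 :=
  if s is i :: s' then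
    \sum_(j in A) cup s' (A :\ j) q *
                  (l i (corner A q) + l i (corner (A :\ j) q))
  else 1.

(** The cup product of [cup s] with the 0-cochain [l i], which is read at the top corner of the
    face. *)
Definition cup_primitive i s A q := cup s A q * l i (corner A q).

(** Leibniz rule. As [cup s] is closed, its sums over the upper and the lower faces agree. All upper
    faces share the top corner [corner A q], so pairing them with the lower faces leaves [cup s]
    times differences of [l i]. *)
Lemma cup_consE i s A q : (forall A q, coboundary (cup s) A q = 0) ->
  cup (i :: s) A q = coboundary (cup_primitive i s) A q.
Proof.
move=> /(_ A q); rewrite /coboundary big_split/= => /addF2_eq0.
move/(congr1 ( *%R^~ (l i (corner A q)))); rewrite !mulr_suml => E.
rewrite [RHS]big_split/=.
under [X in _ = X + _]eq_bigr => j jA do rewrite /cup_primitive corner_setD1//.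
by rewrite E -big_split/=; apply: eq_bigr => j jA; rewrite mulrDr.
Qed.

Lemma coboundary_cup s A q : coboundary (cup s) A q = 0.
Proof.
elim: s A q => [|i s IH] A q; first by apply: big1 => i _; rewrite addF2.
rewrite (_ : cup (i :: s) = coboundary (cup_primitive i s)).
  exact: coboundary_coboundary.
by apply/funext => B; apply/funext => r; exact: cup_consE.
Qed.

(** * Sums over grid boxes and Stokes' theorem *)

Variable p : nat.

Definition linesum i g q : 'F_2 := \sum_(t < p) g (upd i t q).

(** For duplicate-free [s], a sum over the lower corners of the grid cubes in the directions [s];
    the other coordinates stay those of the base point. *)
Definition boxsum s g := foldr linesum g s.

Lemma linesumC i j g q : linesum i (linesum j g) q = linesum j (linesum i g) q.
Proof.
have [->//|ij] := eqVneq i j.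
rewrite /linesum exchange_big/=; apply: eq_bigr => t _; apply: eq_bigr => u _.
by rewrite updC// eq_sym.
Qed.

Lemma boxsum_linesum s i g : boxsum s (linesum i g) = linesum i (boxsum s g).
Proof. by elim: s => //= j s ->; apply/funext => q; exact: linesumC. Qed.

Lemma boxsum0 s q : boxsum s (fun=> 0) q = 0.
Proof. by elim: s q => //= i s IH q; apply: big1 => t _; exact: IH. Qed.

Lemma boxsum_sum s A (F : I -> (I -> nat) -> 'F_2) q :
  boxsum s (fun q => \sum_(i in A) F i q) q = \sum_(i in A) boxsum s (F i) q.
Proof.
elim: s q => //= i s IH q; rewrite /linesum exchange_big/=.
by apply: eq_bigr => t _; exact: IH.
Qed.

Lemma boxsum_neq0 s g q : boxsum s g q != 0 -> exists r, g r != 0.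
Proof.
elim: s q => /= [q gq|i s IH q]; first by exists q.
apply: contra_neqP => /forallNP g0; apply: big1 => t _.
by apply/eqP; apply/negPn/negP => /IH[r]; exact: g0.
Qed.

Lemma boxsum_upd s i t g q : i \notin s ->
  boxsum s (fun q => g (upd i t q)) q = boxsum s g (upd i t q).
Proof.
elim: s q => //= j s IH q; rewrite inE negb_or => /andP[ij ins].
by apply: eq_bigr => u _; rewrite IH// updC.
Qed.

(** Stokes in one direction: the sum telescopes, differences over [F_2] being sums. *)
Lemma linesum_diff i g q :
  linesum i (fun q => g (corner [set i] q) + g q) q =
  g (upd i p q) + g (upd i 0 q).
Proof.
rewrite /linesum; under eq_bigr do rewrite corner_upd.
elim: p => [|n IH]; first by rewrite big_ord0 addF2.
by rewrite big_ord_recr/= IH addrC -addrA [X in _ + X]addrA addF2 add0r addrC.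
Qed.

(** Line sums commute, so the one in direction [i] can be taken first. *)
Lemma boxsum_eq0 i s g q : i \in s -> (forall q, linesum i g q = 0) ->
  boxsum s g q = 0.
Proof.
move=> + g0; elim: s q => //= j s IH q; rewrite inE => /predU1P[<-|js].
  rewrite -boxsum_linesum (_ : linesum i g = fun=> 0) ?boxsum0//.
  exact/funext.
by apply: big1 => t _; exact: IH.
Qed.

(** * Labels with prescribed boundary values, and Kuhn's lemma *)

Hypothesis l0 : forall i q, q i = 0%N -> l i q = 0.
Hypothesis lp : forall i q, q i = p -> l i q = 1.

Lemma corner_notin i A q : i \notin A -> corner A q i = q i.
Proof. by move=> /negbTE iA; rewrite /corner iA addn0. Qed.

(** All corners of the face have the same [i]-th coordinate, 0 or [p], so [l i] is constant on them
    and the factor [d l_i] vanishes. *)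
Lemma cup_face i s A q : i \in s -> i \notin A -> q i = 0%N \/ q i = p ->
  cup s A q = 0.
Proof.
move=> + + qi; elim: s A => //= j s IH A; rewrite inE => ins iA.
apply: big1 => k kA.
have iAk : i \notin A :\ k by rewrite !inE (negbTE iA) andbF.
case/predU1P: ins => [<-|ins]; last by rewrite IH ?mul0r.
suff -> : l i (corner A q) = l i (corner (A :\ k) q) by rewrite addF2 mulr0.
by case: qi => qi; [rewrite !l0 | rewrite !lp]; rewrite ?corner_notin.
Qed.

Lemma boxsum_cup s q : uniq s -> (forall i, i \notin s -> q i = p) ->
  boxsum s (cup s [set:: s]) q = 1.
Proof.
elim: s q => //= i s IH q /andP[ins us] qp.
set A := [set:: i :: s].
have Ai : A :\ i = [set:: s].
  apply/setP => j; rewrite !inE; case: eqVneq => //= ->; exact/esym/negbTE.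
rewrite -boxsum_linesum.
rewrite (_ : (fun _ => _) = coboundary (cup_primitive i s) A); last first.
  by apply/funext => r; exact: cup_consE (coboundary_cup s).
rewrite boxsum_linesum -[LHS]/(boxsum (i :: s) _ q) boxsum_sum.
rewrite (bigD1 i)/=; last by rewrite !inE eqxx.
(* In a direction [j] of [s] both end faces contribute 0, because [d l_j] is still a factor of
   [cup s]. *)
rewrite [X in _ + X]big1 ?addr0 => [|j /andP[]]; last first.
  rewrite !inE => /predU1P[->|js ji]; first by rewrite eqxx.
  rewrite -[LHS]/(boxsum (i :: s) _ q); apply: (boxsum_eq0 j).
    by rewrite inE js orbT.
  move=> r; rewrite linesum_diff /cup_primitive.
  rewrite !(cup_face j) ?mul0r ?addr0 ?inE ?eqxx//.
    by left; rewrite /upd eqxx.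
  by right; rewrite /upd eqxx.
rewrite /= -boxsum_linesum Ai.
(* In direction [i] only the end [q_i = p] survives: [l i] is 1 there and 0 at the other end. *)
rewrite (_ : linesum i _ = fun q => cup s [set:: s] (upd i p q)); last first.
  apply/funext => r; rewrite linesum_diff /cup_primitive.
  rewrite lp; last by rewrite corner_notin ?inE// /upd eqxx.
  by rewrite l0 ?mulr0 ?addr0 ?mulr1// corner_notin ?inE// /upd eqxx.
rewrite boxsum_upd// IH// => j js; rewrite /upd.
by case: eqVneq => // ji; rewrite qp// inE negb_or ji.
Qed.

(** If [l i] took one value on all corners, every term would have a zero factor [d l_i]. *)
Lemma cup_neq0 s A q i : cup s A q != 0 -> i \in s ->
  exists B C, l i (corner B q) != l i (corner C q).
Proof.
elim: s A => //= j s IH A /[swap] ijs.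
apply: contra_neqP => lE; apply: big1 => k _.
case/predU1P: ijs => [ij|ins].
  have [->|lBC] := eqVneq (l j (corner A q)) (l j (corner (A :\ k) q)).
    by rewrite addF2 mulr0.
  by exfalso; apply: lE; exists A, (A :\ k); rewrite ij.
have [->|/IH/(_ ins)//] := eqVneq (cup s (A :\ k) q) 0; by rewrite mul0r.
Qed.

End Cube.

Lemma kuhn_cube (I : finType) (p : nat) (l : I -> (I -> nat) -> bool) :
  (forall i q, q i = 0%N -> ~~ l i q) -> (forall i q, q i = p -> l i q) ->
  exists q, forall i, exists A B, l i (corner A q) /\ ~~ l i (corner B q).
Proof.
move=> l0 lp; pose f i q : 'F_2 := (l i q)%:R.
have f0 i q : q i = 0%N -> f i q = 0 by move=> /l0/negbTE; rewrite /f => ->.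
have fp i q : q i = p -> f i q = 1 by move=> /lp; rewrite /f => ->.
have /boxsum_neq0[q cq] :
    boxsum p (enum I) (cup f (enum I) [set:: enum I]) (fun=> p) != 0.
  by rewrite (boxsum_cup f p f0 fp) ?enum_uniq ?oner_neq0.
exists q => i; have [|B [C]] := cup_neq0 _ _ _ _ i cq.
  by rewrite mem_enum.
rewrite /f; case lB: (l i (corner B q)); case lC: (l i (corner C q));
  rewrite ?eqxx// => _; first by exists B, C; rewrite lB lC.
by exists C, B; rewrite lB lC.
Qed.

(** * Paths and cuts in the unit cube *)

Section UnitCube.
Context {R : realType} {N : nat}.
Implicit Types (x y z : 'rV[R]_N) (K : set 'rV[R]_N) (i j : 'I_N).

(** Paths are continuous on all of [R] and confined to the cube only on [[0, 1]]; gluing them then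
    needs no subspace topology. *)
Definition cuts_cube i K := forall gamma : R -> 'rV[R]_N, continuous gamma ->
  (forall t, 0 <= t <= 1 -> unit_cube (gamma t)) ->
  gamma 0 ord0 i = 0 -> gamma 1 ord0 i = 1 ->
  exists2 t, 0 <= t <= 1 & K (gamma t).

Definition reachable i K x := exists gamma : R -> 'rV[R]_N,
  [/\ continuous gamma,
      forall t, 0 <= t <= 1 -> unit_cube (gamma t) /\ ~ K (gamma t),
      gamma 0 ord0 i = 0 & gamma 1 = x].

(** Points of [K] are never reachable, so the face is added by hand to secure the boundary condition
    of Kuhn's lemma even where [K] meets it. *)
Definition left_side i K x := x ord0 i = 0 \/ reachable i K x.

Lemma unit_cube_segment x y t : unit_cube x -> unit_cube y -> 0 <= t <= 1 ->
  unit_cube (x + t *: (y - x)).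
Proof.
move=> Cx Cy t01 i; rewrite !mxE.
have := Cx i; have := Cy i; move: (x ord0 i) (y ord0 i) t01 => a b.
by move=> /andP[? ?] /andP[? ?] /andP[? ?]; apply/andP; split; nra.
Qed.

Lemma compact_unit_cube : compact (@unit_cube R N).
Proof.
rewrite (_ : unit_cube (N:=N) = [set v | forall i, `[0, 1]%classic (v ord0 i)]).
  apply: (@rV_compact R N (fun=> `[0, 1]%classic)) => _.
  exact: segment_compact.
by apply/seteqP; split=> x Cx i; have := Cx i; rewrite /= in_itv.
Qed.

Lemma left_side_segment i K x y : unit_cube x -> unit_cube y ->
  left_side i K x -> ~ left_side i K y ->
  exists2 t, 0 <= t <= 1 & K (x + t *: (y - x)).
Proof.
move=> Cx Cy lx; apply: contra_notP => /forall2NP xyK; right.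
have {}xyK t : 0 <= t <= 1 -> ~ K (x + t *: (y - x)).
  by move=> t01; have [|] := xyK t.
have nKx : ~ K x by have := xyK 0; rewrite lexx ler01 scale0r addr0; exact.
(* On the face itself the constant path works, as [x] is off [K]. *)
have [g [cg gK g0 g1]] : reachable i K x.
  case: lx => // x0; exists (fun=> x); split=> // t; exact: cst_continuous.
(* [g] at double speed, then the segment from [x] to [y], in one formula. *)
pose u t : R := Num.min (2 * t) 1; pose v t : R := Num.max (2 * t - 1) 0.
have cu : continuous u.
  move=> t; apply: (@continuous_min _ _ (fun t : R => 2 * t) (fun=> 1)).
    by apply: cvgM; [exact: cvg_cst|exact: cvg_id].
  exact: cvg_cst.
have cv : continuous v.
  move=> t; apply: (@continuous_max _ _ (fun t : R => 2 * t - 1) (fun=> 0)).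
    apply: cvgB; last exact: cvg_cst.
    by apply: cvgM; [exact: cvg_cst|exact: cvg_id].
  exact: cvg_cst.
exists (fun t => g (u t) + v t *: (y - x)); split.
- move=> t; apply: cvgD; first by apply: continuous_comp; [exact: cu|exact: cg].
  by apply: cvgZr_tmp; exact: cv.
- move=> t /andP[t0 t1]; rewrite /u /v; have [t2|t2] := leP (2 * t) 1.
    rewrite max_r; last lra.
    by rewrite scale0r addr0; apply: gK; lra.
  rewrite max_l; last lra.
  rewrite g1; split; last by apply: xyK; lra.
  by apply: unit_cube_segment => //; lra.
- by rewrite /u /v mulr0 min_l ?ler01// max_r ?scale0r ?addr0//; lra.
- rewrite /u /v min_r; last lra.
  rewrite max_l; last lra.
  by rewrite (_ : 2 * 1 - 1 = 1) ?scale1r ?g1 1?addrC ?subrK//; lra.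
Qed.

Lemma left_sidePn i K y : cuts_cube i K -> y ord0 i = 1 -> ~ left_side i K y.
Proof.
move=> cK y1 [y0|[g [cg gK g0 g1]]].
  by have := oner_neq0 R; rewrite -y1 y0 eqxx.
have [|||t t01] := cK g cg => //; last by have [] := gK t t01.
  by move=> t /gK[].
by rewrite g1.
Qed.

(* Coordinates are clamped at [m], so that any [q] gives a point of the cube. *)
Definition grid_point (m : nat) (q : 'I_N -> nat) : 'rV[R]_N :=
  \row_j ((minn (q j) m)%:R / m%:R).

Lemma grid_point_unit_cube m q : unit_cube (grid_point m.+1 q).
Proof.
move=> i; rewrite mxE divr_ge0//= ler_pdivrMr ?ltr0n// mul1r ler_nat.
exact: geq_minr.
Qed.

Lemma grid_point_corner m q A j :
  `|grid_point m.+1 (corner A q) ord0 j - grid_point m.+1 q ord0 j|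
    <= m.+1%:R^-1.
Proof.
rewrite !mxE -mulrBl normrM [X in _ * X]ger0_norm ?invr_ge0//.
rewrite ler_piMl ?invr_ge0// -natrB; last first.
  by rewrite leq_min geq_minr geq_min leq_addr.
rewrite normr_nat -[leRHS]/(1%:R) ler_nat leq_subLR /corner.
by case: (j \in A); lia.
Qed.

Lemma near_all_cuts (K : 'I_N -> set 'rV[R]_N) m :
  (forall i, cuts_cube i (K i)) ->
  exists z, unit_cube z /\
    forall i, exists2 y, K i y & forall j, `|z ord0 j - y ord0 j| <= m.+1%:R^-1.
Proof.
move=> cK.
(* The negation makes the label false on [q_i = 0] and, by the cut, true on [q_i = m + 1]. *)
pose l i q := `[< ~ left_side i (K i) (grid_point m.+1 q) >].
have [i q qi|i q qi|q ql] := @kuhn_cube 'I_N m.+1 l.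
- by apply/negP => /asboolP; apply; left; rewrite mxE qi min0n mul0r.
- apply/asboolP; apply: left_sidePn => //.
  by rewrite mxE qi minnn divff ?pnatr_eq0.
exists (grid_point m.+1 q); split; first exact: grid_point_unit_cube.
move=> i; have [A [B [/asboolP lA /asboolP/contrapT lB]]] := ql i.
have [t t01 Kt] := left_side_segment _ _ _ _ (grid_point_unit_cube _ _)
  (grid_point_unit_cube _ _) lB lA.
exists (grid_point m.+1 (corner B q) +
  t *: (grid_point m.+1 (corner A q) - grid_point m.+1 (corner B q))) => // j.
(* Both ends of the segment are within the mesh of the lower corner in each coordinate, hence so is
   each point between them. *)
have := grid_point_corner m q A j; have := grid_point_corner m q B j.
move: (grid_point m.+1 (corner A q)) (grid_point m.+1 (corner B q)) => u v.
rewrite !mxE -/(grid_point m.+1 q) => vq uq.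
move: (u ord0 j) (v ord0 j) m.+1%:R^-1 (_ / m.+1%:R) uq vq => a b d c.
rewrite !ler_norml; move: t01 => /andP[t0 t1] /andP[a1 a2] /andP[b1 b2].
by apply/andP; split; nra.
Qed.

Lemma cuts_cube_meet (K : 'I_N -> set 'rV[R]_N) :
  (forall i, closed (K i)) -> (forall i, cuts_cube i (K i)) ->
  exists x, forall i, K i x.
Proof.
move=> clK cK; have /choice[z zP] := near_all_cuts K ^~ cK.
have [|x [_ xz]] := compact_unit_cube (z @ \oo).
  by exists 0%N => // m _; have [] := zP m.
exists x => i; apply: clK => B /nbhs_ballP[e/= e0 eB].
have e20 : 0 < e / 2 by rewrite divr_gt0.
(* The terms with mesh below [e / 2] contain a tail of the sequence, so one of them lies within
   [e / 2] of the cluster point; the other half of [e] covers the distance to [K i]. *)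
have zF : (z @ \oo) [set z m | m in [set m : nat | m.+1%:R^-1 < e / 2]].
  have := near_infty_natSinv_lt (PosNum e20); apply: filterS => m me.
  by exists m.
have [_ [[m me <-] [_ zm]]] := xz _ _ zF (nbhsx_ballx x _ e20).
have [_ /(_ i)[y Ky zy]] := zP m.
exists y; split=> //; apply: eB; split=> // a j; rewrite ord1.
have := zm ord0 j; have := zy j; rewrite /ball/= => zyj xzj.
rewrite (splitr e) (le_lt_trans (ler_distD (z m ord0 j) _ _))// ltrD//.
exact: le_lt_trans zyj me.
Qed.

End UnitCube.

(** * Transfer between the cube and [X] *)

Lemma homeomorphic_cube_path (R : realType) (N : nat) (Z : topologicalType)
    (X : set Z) (h : 'rV[R]_N -> Z) (gamma : R -> 'rV[R]_N) :
  homeomorphism_on (@unit_cube R N) X h -> continuous gamma ->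
  (forall t, 0 <= t <= 1 -> unit_cube (gamma t)) -> is_path X (h \o gamma).
Proof.
move=> [[hX _ _] hc _] cg gC; split; last first.
  by move=> _ [t + <-]; rewrite /= in_itv => /gC; exact: hX.
apply/(subspace_continuousP _ (h \o gamma)) => t /=; rewrite in_itv => t01 U hU.
have /subspace_continuousP/(_ (gamma t) (gC t t01) U hU)/(cg t) := hc.
apply: (@filterS _ _ (nbhs_filter t)) => s sU /=.
by rewrite in_itv => /gC; exact: sU.
Qed.

Theorem theorem3p2 (R : realType) (N : nat) (Z : metricType R) (X : set Z)
    (h : 'rV[R]_N -> Z) (S : 'I_N -> set Z)
    (hX : generalized_rectangle X h)
    (hS : forall i : 'I_N, [/\ compact (S i), S i `<=` X &
            cuts_arcs X (left_face h i) (right_face h i) (S i)]) :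
  \bigcap_(i in [set: 'I_N]) S i !=set0.
Proof.
have [[_ _ hsurj] _ [g gh cg]] := hX.
(* The inverse [g] is continuous on [X], so [S i] pulls back to a compact, hence closed, set. *)
have [||x xS] := @cuts_cube_meet R N (fun i => g @` S i).
- move=> i; have [cS SX _] := hS i.
  apply: compact_closed; first exact: norm_hausdorff.
  by apply: continuous_compact => //; exact: continuous_subspaceW cg.
- move=> i gamma cgam gC g0 g1; have [_ _ cS] := hS i.
  have gp := homeomorphic_cube_path _ _ _ _ _ _ hX cgam gC.
  have [||_ [[t t01 <-] St]] := cS _ gp.
  + exists (h (gamma 0)); split.
      by exists 0; rewrite //= in_itv/= lexx ler01.
    by exists (gamma 0) => //; split=> //; apply: gC; rewrite lexx ler01.
  + exists (h (gamma 1)); split.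
      by exists 1; rewrite //= in_itv/= lexx ler01.
    by exists (gamma 1) => //; split=> //; apply: gC; rewrite lexx ler01.
  + move: t01; rewrite /= in_itv => t01; exists t => //.
    by exists (h (gamma t)) => //; rewrite gh//; exact: gC.
exists (h x) => i _; have [s Ss <-] := xS i.
have [_ SX _] := hS i.
by have [y Cy hy] := hsurj _ (SX _ Ss); rewrite -hy gh// hy.
Qed.
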